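(* For $i\in\{4,5,6\}$ let $Q_{S_i}(x)=1+\sum_{n\ge 1}|A_{S_i}(n)|x^n$, where $A_{S_i}(n)$ is the set of lattice paths from $(0,0)$ to $(2n,0)$ with steps in $S_i$ that never go below the $x$-axis and have no horizontal steps on the $x$-axis. Then \begin{align*} Q_{S_4}(x)&=\frac{1+4x-\sqrt{1-12x+16x^2}}{10x},\\ Q_{S_5}(x)&=\frac{-1+\sqrt{1-8x+12x^2-4x^3}}{2x(x-2)},\\ Q_{S_6}(x)&=\frac{-1-4x+x^2+\sqrt{(1-x)(1-11x+7x^2-x^3)}}{2x(x-5)}. \end{align*}
   Context: The step sets are $S_4=\{(r,r),(r,-r),(2r,0)\mid r\in\mathbb{N}^+\}$, $S_5=\{(1,1),(1,-1),(2r,0)\mid r\in\mathbb{N}^+\}$, $S_6=\{(r,r),(r,-r),(2,0)\mid r\in\mathbb{N}^+\}$, where $\mathbb{N}^+$ is the set of positive integers. Steps $(2r,0)$ are called horizontal steps. A lattice path is a finite sequence of steps; paths with different step sequences are distinct even if they trace the same curve. Identities are between formal power series in $x$, and each square root is the one with constant term $1$. *)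

(* Defs.v *)
From HB Require Import structures.
From mathcomp Require Import all_boot all_order all_algebra.
From mathcomp Require Import finmap.
From mathcomp Require Import mathcomp_extra boolp classical_sets functions.
From mathcomp Require Import cardinality.
From mathcomp Require Import ring zify.

Set Implicit Arguments.
Unset Strict Implicit.
Unset Printing Implicit Defensive.

Import Order.TTheory GRing.Theory Num.Theory.

Local Open Scope classical_set_scope.
Local Open Scope ring_scope.

Record fps (K : Type) := Fps { coefs : nat -> K }.

Section FpsRing.
Variable K : fieldType.
Implicit Types f g h : fps K.

Lemma fps_ext f g : coefs f =1 coefs g -> f = g.
Proof. by case: f g => [f] [g] /= /funext ->. Qed.

HB.instance Definition _ := gen_eqMixin (fps K).
HB.instance Definition _ := gen_choiceMixin (fps K).

Definition fps_add f g : fps K := Fps (fun n => coefs f n + coefs g n).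
Definition fps_opp f : fps K := Fps (fun n => - coefs f n).
Definition fps_const (c : K) : fps K := Fps (fun n => if n is 0%N then c else 0).
Definition fps_mul f g : fps K :=
  Fps (fun n => \sum_(i < n.+1) coefs f i * coefs g (n - i)%N).

Lemma fps_addA : associative fps_add.
Proof. by move=> f g h; apply: fps_ext => n /=; rewrite addrA. Qed.
Lemma fps_addC : commutative fps_add.
Proof. by move=> f g; apply: fps_ext => n /=; rewrite addrC. Qed.
Lemma fps_add0 : left_id (fps_const 0) fps_add.
Proof. by move=> f; apply: fps_ext => -[|n] /=; rewrite add0r. Qed.
Lemma fps_addN : left_inverse (fps_const 0) fps_opp fps_add.
Proof. by move=> f; apply: fps_ext => -[|n] /=; rewrite addNr. Qed.

HB.instance Definition _ :=
  GRing.isZmodule.Build (fps K) fps_addA fps_addC fps_add0 fps_addN.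

Let trunc N f : {poly K} := \poly_(i < N) coefs f i.

Let coef_trunc_mul N f g n : (n < N)%N ->
  (trunc N f * trunc N g)`_n = coefs (fps_mul f g) n.
Proof.
move=> nN; rewrite coefM; apply: eq_bigr => i _; rewrite !coef_poly.
by rewrite !ifT //; [lia | have := ltn_ord i; lia].
Qed.

Let trunc_eq (p q p' q' : {poly K}) n :
  (forall i, (i <= n)%N -> p`_i = p'`_i) ->
  (forall i, (i <= n)%N -> q`_i = q'`_i) -> (p * q)`_n = (p' * q')`_n.
Proof.
move=> pp qq; rewrite !coefM; apply: eq_bigr => i _.
by rewrite pp ?qq ?leq_subr // -ltnS ltn_ord.
Qed.

Lemma fps_mulC : commutative fps_mul.
Proof.
move=> f g; apply: fps_ext => n.
by rewrite -!(@coef_trunc_mul n.+1) // mulrC.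
Qed.

Lemma fps_mulA : associative fps_mul.
Proof.
move=> f g h; apply: fps_ext => n; rewrite -!(@coef_trunc_mul n.+1) //.
have tr_mul a b i : (i <= n)%N ->
  (trunc n.+1 (fps_mul a b))`_i = (trunc n.+1 a * trunc n.+1 b)`_i.
  by move=> le_in; rewrite coef_poly ltnS le_in (@coef_trunc_mul n.+1).
transitivity ((trunc n.+1 f * (trunc n.+1 g * trunc n.+1 h))`_n).
  by apply: trunc_eq => // i; exact: tr_mul.
by rewrite mulrA; apply: trunc_eq => // i le_in; rewrite tr_mul.
Qed.

Lemma fps_mul1 : left_id (fps_const 1) fps_mul.
Proof.
move=> f; apply: fps_ext => n /=; rewrite big_ord_recl /= mul1r subn0.
by rewrite big1 ?addr0 // => i _; rewrite mul0r.
Qed.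

Lemma fps_mulDl : left_distributive fps_mul +%R.
Proof.
move=> f g h; apply: fps_ext => n /=; rewrite -big_split /=.
by apply: eq_bigr => i _; rewrite mulrDl.
Qed.

Lemma fps_one_neq0 : fps_const 1 != 0.
Proof.
by apply/eqP => /(congr1 (fun f => coefs f 0)) /eqP; rewrite /= oner_eq0.
Qed.

HB.instance Definition _ := GRing.Zmodule_isComNzRing.Build (fps K)
  fps_mulA fps_mulC fps_mul1 fps_mulDl fps_one_neq0.

Lemma coefsD f g n : coefs (f + g) n = coefs f n + coefs g n.
Proof. by []. Qed.
Lemma coefsN f n : coefs (- f) n = - coefs f n.
Proof. by []. Qed.
Lemma coefs0 n : coefs (0 : fps K) n = 0.
Proof. by case: n. Qed.
Lemma coefs1 n : coefs (1 : fps K) n = (n == 0%N)%:R.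
Proof. by case: n. Qed.
Lemma coefsM f g n :
  coefs (f * g) n = \sum_(i < n.+1) coefs f i * coefs g (n - i)%N.
Proof. by []. Qed.

Definition fps_unit : {pred fps K} := fun f => `[< exists g, g * f = 1 >].
Definition fps_inv f : fps K :=
  if pselect (exists g, g * f = 1) is left fU then sval (cid fU) else f.

Lemma fps_mulVf : {in fps_unit, left_inverse 1 fps_inv *%R}.
Proof.
move=> f /asboolP fU; rewrite /fps_inv; case: pselect => // fU'.
exact: svalP (cid fU').
Qed.
Lemma fps_unitPl f g : g * f = 1 -> fps_unit f.
Proof. by move=> gf; apply/asboolP; exists g. Qed.
Lemma fps_inv_out : {in [predC fps_unit], fps_inv =1 id}.
Proof.
by move=> f /asboolP fU; rewrite /fps_inv; case: pselect.
Qed.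

HB.instance Definition _ := GRing.ComNzRing_hasMulInverse.Build (fps K)
  fps_mulVf fps_unitPl fps_inv_out.

Lemma fps_integral : GRing.integral_domain_axiom (fps K).
Proof.
move=> f g fg0; apply: contrapT => /negP; rewrite negb_or => /andP[f0 g0].
have nz h : h != 0 -> exists n, coefs h n != 0.
  move=> h0; apply: contrapT => hn; move/negP: h0; apply; apply/eqP.
  apply: fps_ext => n; rewrite coefs0; apply/eqP.
  by apply: contrapT => /negP hn0; apply: hn; exists n.
case: (ex_minnP (nz f f0)) => m fm mmin.
case: (ex_minnP (nz g g0)) => l gl lmin.
have := congr1 (fun h => coefs h (m + l)) fg0.
have lt_ml : (m < (m + l).+1)%N by lia.
rewrite coefs0 coefsM (bigD1 (Ordinal lt_ml)) //= addKn big1 => [|i im].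
  by move/eqP; rewrite addr0 mulf_eq0 (negPf fm) (negPf gl).
have {}im : (i : nat) != m by [].
case: (ltnP i m) => [lt_im | le_mi].
  have -> : coefs f i = 0; last by rewrite mul0r.
  by apply/eqP/negPn/negP => /mmin; lia.
have -> : coefs g (m + l - i)%N = 0; last by rewrite mulr0.
by have lt_i := ltn_ord i; apply/eqP/negPn/negP => /lmin; lia.
Qed.

HB.instance Definition _ :=
  GRing.ComUnitRing_isIntegral.Build (fps K) fps_integral.

Definition fpsX : fps K := Fps (fun n => (n == 1%N)%:R).

(** The default value [0] is never used when [coefs f 0 = 1] and the
    characteristic is not 2, see [fps_sqrtP] and [fps_sqrt_unique]. *)
Definition fps_sqrt f : fps K :=
  xget 0 [set s : fps K | s ^+ 2 = f /\ coefs s 0 = 1].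

End FpsRing.

Arguments fpsX {K}.

Section FpsSqrt.
Variable K : numFieldType.
Implicit Types f s : fps K.

Fixpoint sqrt_coefs f n : seq K :=
  if n is m.+1 then
    let s := sqrt_coefs f m in
    rcons s (if m is 0%N then 1 else
      (coefs f m - \sum_(i < m.-1) s`_i.+1 * s`_(m - i.+1)) / 2)
  else [::].

Lemma fps_sqrt_ex f : coefs f 0 = 1 ->
  exists s : fps K, s ^+ 2 = f /\ coefs s 0 = 1.
Proof.
move=> f0; pose s := Fps (fun n => (sqrt_coefs f n.+1)`_n).
have sz n : size (sqrt_coefs f n) = n.
  by elim: n => //= n IH; rewrite size_rcons IH.
have sE n i : (i < n)%N -> (sqrt_coefs f n)`_i = coefs s i.
  elim: n => // n IH; rewrite ltnS leq_eqVlt => /predU1P[-> //|lt_in].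
  by rewrite /= nth_rcons sz lt_in IH.
exists s; split=> //; apply: fps_ext => -[|n].
  by rewrite expr2 coefsM big_ord1 /= mulr1.
rewrite expr2 coefsM big_ord_recl big_ord_recr /= subn0 subnn.
rewrite -[(sqrt_coefs f 1)`_0]/(1 : K) mul1r mulr1.
rewrite -[nth 0 (rcons _ _) _]/(coefs s n.+1).
have -> : coefs s n.+1 =
    (coefs f n.+1 - \sum_(i < n) coefs s i.+1 * coefs s (n.+1 - i.+1)) / 2.
  rewrite {1}/s /= nth_rcons size_rcons sz ltnn eqxx; congr (_ / 2).
  congr (_ - _); apply: eq_bigr => i _; have lt_in := ltn_ord i.
  rewrite -[rcons _ _]/(sqrt_coefs f n.+1) !sE //; lia.
set S := \sum_(i < n) coefs s i.+1 * _.
by field.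
Qed.

Lemma fps_sqrtP f : coefs f 0 = 1 ->
  fps_sqrt f ^+ 2 = f /\ coefs (fps_sqrt f) 0 = 1.
Proof.
move=> /fps_sqrt_ex ex_s.
exact: (@xgetPex _ 0 [set s : fps K | s ^+ 2 = f /\ coefs s 0 = 1] ex_s).
Qed.

Lemma fps_sqrt_unique f s :
  s ^+ 2 = f -> coefs s 0 = 1 -> fps_sqrt f = s.
Proof.
move=> sf s0; have f0 : coefs f 0 = 1.
  by rewrite -sf expr2 coefsM big_ord1 /= s0 mulr1.
have [tf t0] := fps_sqrtP f0.
have /eqP := etrans tf (esym sf); rewrite eqf_sqr => /orP[/eqP //|/eqP tN].
have := t0; rewrite tN coefsN s0 => /eqP.
by rewrite eq_sym -addr_eq0 -mulr2n pnatr_eq0.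
Qed.

End FpsSqrt.

Definition step : Type := (int * int)%type.
Definition lattice_path : Type := seq step.

Definition S4 : set step := [set s | exists2 r : int, 0 < r &
  [\/ s = (r, r), s = (r, - r) | s = (2 * r, 0)]].
Definition S5 : set step := [set s | exists2 r : int, 0 < r &
  [\/ s = (1, 1), s = (1, - 1) | s = (2 * r, 0)]].
Definition S6 : set step := [set s | exists2 r : int, 0 < r &
  [\/ s = (r, r), s = (r, - r) | s = (2, 0)]].

Definition horizontal (s : step) : Prop :=
  exists2 r : int, 0 < r & s = (2 * r, 0).

(** The point reached from the origin after the first [k] steps of [p]. *)
Definition vertex (p : lattice_path) (k : nat) : int * int := \sum_(s <- take k p) s.

(** Steps are line segments, so a path stays weakly above the axis as soon as
    its vertices do, and a horizontal step lies on the axis as soon as it starts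
    there. *)
Definition A (S : set step) (n : nat) : set lattice_path := [set p : lattice_path |
  [/\ forall s, s \in p -> S s,
      vertex p (size p) = (n.*2%:Z, 0),
      forall k, (k <= size p)%N -> 0 <= (vertex p k).2
    & forall k, (k < size p)%N ->
        (vertex p k).2 = 0 -> ~ horizontal (nth 0 p k)]].

(** [fset_set] sends infinite sets to the empty one; the sets [A S n] used here
    are finite by [A_finite] and [S4_short], [S5_short], [S6_short]. *)
Definition Q (S : set step) : fps rat :=
  1 + Fps (fun n => if (1 <= n)%N then #|` fset_set (A S n)|%:R else 0).

Definition short (s : step) : Prop := 0 < s.1 /\ `|s.2| <= s.1.

Lemma S4_short : S4 `<=` short.
Proof. by move=> s [r r0 [] ->]; rewrite /short /=; lia. Qed.
Lemma S5_short : S5 `<=` short.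
Proof. by move=> s [r r0 [] ->]; rewrite /short /=; lia. Qed.
Lemma S6_short : S6 `<=` short.
Proof. by move=> s [r r0 [] ->]; rewrite /short /=; lia. Qed.

Lemma A_finite (S : set step) n : S `<=` short -> finite_set (A S n).
Proof.
move=> Sshort.
pose B := [set s : step | short s /\ s.1 <= n.*2%:Z].
have finB : finite_set B.
  pose g (a b : nat) : step := (a%:Z, b%:Z - n.*2%:Z).
  apply: (@sub_finite_set _ _
    [set g a b | a in `I_(n.*2.+1) & b in `I_(n.*2.*2.+1)]).
    case=> a b [[/= a0 ba] an].
    exists (absz a); first by rewrite /=; lia.
    exists (absz (b + n.*2%:Z)); first by rewrite /=; lia.
    by rewrite /g; congr pair; lia.
  by apply: finite_image2; exact: finite_II.
pose C L := [set p : lattice_path |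
  (size p <= L)%N /\ forall s, s \in p -> B s].
have finC L : finite_set (C L).
  elim: L => [|L IH].
    apply: (@sub_finite_set _ _ [set [::]]); last exact: finite_set1.
    by case=> //= s p [].
  apply: (@sub_finite_set _ _
    ([set [::]] `|` [set s :: p | s in B & p in C L])).
    case=> [|s p] [/= szp pB]; first by left.
    right; exists s; first by apply: pB; rewrite mem_head.
    by exists p => //; split=> // t tp; apply: pB; rewrite inE tp orbT.
  by rewrite finite_setU; split; [exact: finite_set1 | exact: finite_image2].
apply: sub_finite_set (finC n.*2) => p [pS + _ _].
rewrite /vertex take_size => /(congr1 fst) /= pE.
have {pE} : (\sum_(s <- p) s.1 : int) <= n.*2%:Z.
  by rewrite -pE -(raddf_sum fst).
have {pS} : forall s, s \in p -> short s by move=> s /pS /Sshort.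
rewrite /C /B /=; move: (n.*2) => N.
elim: p N => [|s p IH] N ps; first by split.
rewrite big_cons => sp.
have [s0 _] := ps s (mem_head _ _).
have psh := ps.
have {}ps t : t \in p -> short t by move=> tp; apply: ps; rewrite inE tp orbT.
have sum0 : 0 <= \sum_(t <- p) t.1.
  by rewrite big_seq sumr_ge0 // => t /ps[/ltW].
move: sp (IH (absz (\sum_(t <- p) t.1)) ps).
rewrite gez0_abs // => sp /(_ (lexx _)).
move: (\sum_(t <- p) t.1) sum0 sp => T T0 sp [szp pB]; split=> [|t].
  by rewrite /=; lia.
rewrite inE => /predU1P[->|/pB[ts tT]]; last by split=> //; lia.
by split; [apply: psh; exact: mem_head | lia].
Qed.

Notation "x %:F" := (@FracField.tofrac _ x) : ring_scope.

(* Main.v *)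
(* Let E_k(x) count, by width, the paths from height k down to the axis, a path
   of width 2 n + k contributing x^n. Removing the first step gives a linear
   recursion that determines the E_k, and it is solved by a geometric
   progression in k whose ratio w is a root of the (quadratic) kernel equation;
   eliminating w leaves a quadratic equation for E_0 = Q. *)
Require Import Defs.
From mathcomp Require Import all_boot all_order all_algebra.
From mathcomp Require Import finmap.
From mathcomp Require Import boolp classical_sets cardinality.
From mathcomp Require Import ring zify.

Set Implicit Arguments.
Unset Strict Implicit.
Unset Printing Implicit Defensive.

Import Order.TTheory GRing.Theory Num.Theory.

Local Open Scope ring_scope.

(** Deduces one identity from another, usually multiplied by a cofactor first; the comparison of
    differences is left to [ring]. *)
Lemma eq_of_subr (V : zmodType) (a b c d : V) : a = b -> c - d = a - b -> c = d.
Proof. by move=> -> /eqP; rewrite subrr subr_eq0 => /eqP. Qed.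

(** * Power series: fixed points and infinite sums *)

Section PowerSeries.
Variable K : fieldType.
Implicit Types f g a b c : fps K.
Local Notation x := (fpsX : fps K).

Lemma coefs0M f g : coefs (f * g) 0 = coefs f 0 * coefs g 0.
Proof. by rewrite coefsM big_ord1. Qed.

Lemma coefs0_nat n : coefs (n%:R : fps K) 0 = n%:R.
Proof. by elim: n => // n IH; rewrite -addn1 !natrD coefsD IH. Qed.

Lemma coefsXM f n : coefs (x * f) n = if n is m.+1 then coefs f m else 0.
Proof.
case: n => [|n]; first by rewrite coefs0M mul0r.
rewrite coefsM 2!big_ord_recl big1 /= => [|i _]; last by rewrite mul0r.
by rewrite mul0r add0r mul1r addr0 subSS subn0.
Qed.

Lemma coefs0_neq0 f : coefs f 0 != 0 -> f != 0.
Proof. by apply: contraNneq => ->; rewrite coefs0. Qed.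

Lemma fpsX_neq0 : x != 0.
Proof.
by apply/eqP => /(congr1 (fun f => coefs f 1)) /eqP; rewrite /= oner_eq0.
Qed.

Lemma sum_pred1_iota (F : nat -> K) n :
  \sum_(r <- iota 1 n | pred1 1%N r) F r = if n is 0%N then 0 else F 1%N.
Proof.
case: n => [|n]; first by rewrite big_nil.
rewrite /= big_cons /= big_seq_cond big1 ?addr0 // => r.
by rewrite mem_iota => /andP[/andP[]]; lia.
Qed.

(** Congruence modulo [x ^+ n]. *)
Definition agree n f g := forall i, (i < n)%N -> coefs f i = coefs g i.

Lemma agreeD n f f' g g' :
  agree n f f' -> agree n g g' -> agree n (f + g) (f' + g').
Proof. by move=> ff gg i lt_in; rewrite !coefsD ff ?gg. Qed.

Lemma agreeM n f f' g g' :
  agree n f f' -> agree n g g' -> agree n (f * g) (f' * g').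
Proof.
move=> ff gg i lt_in; rewrite !coefsM; apply: eq_bigr => j _.
by have := ltn_ord j => ltj; rewrite ff ?gg //; lia.
Qed.

(** The factor [x] makes the right-hand side a contraction: congruence modulo [x ^+ n] improves to
    [x ^+ n.+1]. Hence the iterates from 0 converge coefficientwise. *)
Lemma quadratic_fixpoint a b c :
  exists f, f = a + x * (b * f + c * f ^+ 2).
Proof.
pose F f := a + x * (b * f + c * f ^+ 2).
have agreeF n f g : agree n f g -> agree n.+1 (F f) (F g).
  move=> fg; apply: agreeD => // -[|i] lt_in; rewrite !coefsXM //.
  by apply: (agreeD (agreeM _ fg) (agreeM _ (agreeM fg fg))) lt_in.
pose it n := iter n F 0.
have agreeS n : agree n (it n) (it n.+1) by elim: n => // n /agreeF.
have agree_it n m : agree n (it n) (it (m + n)%N).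
  elim: m => [//|m IH] i lt_in; rewrite IH // addSn.
  by apply: agreeS; lia.
(* Coefficient [n] no longer changes from iterate [n.+1] on. *)
pose f := Fps (fun n => coefs (it n.+1) n); exists f.
have agreef n : agree n (it n) f.
  move=> i lt_in; rewrite -[RHS]/(coefs (it i.+1) i).
  by rewrite (@agree_it i.+1 (n - i.+1)%N) ?subnK.
by apply: fps_ext => n; apply: (agreeF n (it n) f (@agreef n)).
Qed.

Lemma linear_fixpoint a b : exists f, f = a + x * (b * f).
Proof.
by have [f] := quadratic_fixpoint a b 0; rewrite mul0r addr0; exists f.
Qed.

(** Unrolling gives [V k] as the sum of [x ^+ r * E (k + r)] over [r >= 1], the contribution of all
    up steps; terms with [r > n] do not reach coefficient [n]. *)
Lemma diagonal_sumE (E V : nat -> fps K) k n :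
  (forall j, V j = x * (E j.+1 + V j.+1)) ->
  coefs (V k) n = \sum_(r <- iota 1 n) coefs (E (k + r)%N) (n - r).
Proof.
move=> VE; elim: n k => [|n IH] k; first by rewrite VE coefsXM big_nil.
rewrite VE coefsXM coefsD IH /= big_cons subSS subn0 addn1; congr (_ + _).
rewrite (iotaDl 1 1 n) big_map; apply: eq_bigr => r _.
by rewrite addSnnS subSS add1n.
Qed.

(** The counterpart for down steps, which carry no power of [x]: removing one from width [2 n + k]
    leaves [n] unchanged. *)
Lemma prefix_sumE (E D : nat -> fps K) k n :
  D 0%N = 0 -> (forall j, D j.+1 = E j + D j) ->
  coefs (D k) n = \sum_(r <- iota 1 k) coefs (E (k - r)%N) n.
Proof.
move=> D0 DE; elim: k => [|k IH]; first by rewrite D0 coefs0 big_nil.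
rewrite DE coefsD IH /= big_cons subSS subn0; congr (_ + _).
rewrite (iotaDl 1 1 k) big_map; apply: eq_bigr => r _.
by rewrite add1n subSS.
Qed.

Lemma tofrac_div (f g h : fps K) : g != 0 -> f * g = h -> f%:F = h%:F / g%:F.
Proof. by move=> g0 <-; rewrite tofracM mulfK ?tofrac_eq0. Qed.

End PowerSeries.

(** * A common form of the step sets, and paths from any height *)

Definition step_set (u h : pred nat) : set step := [set s |
  exists2 r : nat, (0 < r)%N &
    u r /\ (s = (r%:Z, r%:Z) \/ s = (r%:Z, - r%:Z)) \/
    h r /\ s = (2 * r%:Z, 0)]%classic.

(** Extends [A] to a starting height [y] and a displacement [d], so that removing the first step
    stays within the notion. *)
Definition path_from (S : set step) (y : int) (d : step) (p : lattice_path) :=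
  [/\ forall s, s \in p -> S s,
      vertex p (size p) = d,
      forall k, (k <= size p)%N -> 0 <= y + (vertex p k).2
    & forall k, (k < size p)%N ->
        y + (vertex p k).2 = 0 -> ~ horizontal (nth 0 p k)].

Lemma path_from_nil S y d : path_from S y d [::] <-> d = 0 /\ 0 <= y.
Proof.
split=> [[_ + /(_ 0%N isT)]|[-> y0]].
  by rewrite /vertex /= big_nil addr0 => <-.
split=> // [|k _]; rewrite /vertex ?take_nil /= big_nil //.
by rewrite addr0.
Qed.

Lemma path_from_cons S y d s p : path_from S y d (s :: p) <->
  [/\ S s, 0 <= y, y = 0 -> ~ horizontal s & path_from S (y + s.2) (d - s) p].
Proof.
have vtx0 : vertex (s :: p) 0 = 0 by rewrite /vertex /= big_nil.
have vtxS k : vertex (s :: p) k.+1 = s + vertex p k.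
  by rewrite /vertex /= big_cons.
have heightS k : y + (vertex (s :: p) k.+1).2 = y + s.2 + (vertex p k).2.
  by rewrite vtxS addrA.
split=> [[pS pd ge0 nh]|[Ss y0 nh0 [pS pd ge0 nh]]].
  split; first by apply: pS; rewrite mem_head.
  - by have := ge0 0%N isT; rewrite vtx0 addr0.
  - by move=> y0; apply: (nh 0%N isT); rewrite vtx0 addr0.
  split=> [t tp||k lek|k ltk]; first by apply: pS; rewrite inE tp orbT.
  - by rewrite -pd vtxS addrC addKr.
  - by rewrite -heightS; apply: ge0.
  - by rewrite -heightS; apply: nh.
split=> [t|||].
- by rewrite inE => /predU1P[->//|/pS].
- by rewrite vtxS pd addrC subrK.
- by case=> [|k] lek; rewrite ?vtx0 ?addr0 // heightS; apply: ge0.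
- by case=> [|k] ltk; rewrite ?vtx0 ?addr0 // heightS; apply: nh.
Qed.

Lemma path_from_ge0 S y d p : path_from S y d p -> 0 <= y.
Proof. by case: p => [/path_from_nil[]|s p /path_from_cons[]]. Qed.

Lemma path_from_short S y d p : (S `<=` short)%classic -> path_from S y d p ->
  `|d.2| <= d.1.
Proof.
move=> Ssh; elim: p y d => [|s p IH] y d; first by case/path_from_nil=> ->.
case/path_from_cons=> /Ssh[s1 s2] _ _ /IH /=; lia.
Qed.

(** * Enumeration and counting of paths by their first step *)

Section Counting.
Variables u h : pred nat.
Local Notation S := (step_set u h).

Lemma step_set_short : (S `<=` short)%classic.
Proof. by move=> s [r r0 [[_ [|]]|[_]] ->]; rewrite /short /=; lia. Qed.

(* First steps available at height [k] to a path of width [2 n + k] that ends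
   on the axis. *)
Definition first_steps (n k : nat) : seq step :=
  [seq (r%:Z, r%:Z) | r <- iota 1 n & u r] ++
  [seq (r%:Z, - r%:Z) | r <- iota 1 k & u r] ++
  (if (0 < k)%N then [seq (2 * r%:Z, 0 : int) | r <- iota 1 n & h r] else [::]).

(** Lists the paths of width [2 n + k] from height [k] to the axis. A step lowers [2 n] by
    [s.1 + s.2], which is [2 r], 0 or [2 r] for an up, down or horizontal step. *)
Fixpoint paths (fuel n k : nat) : seq lattice_path :=
  (if (n == 0%N) && (k == 0%N) then [:: [::]] else [::]) ++
  if fuel is m.+1 then
    [seq s :: p | s <- first_steps n k,
                  p <- paths m (n - (absz (s.1 + s.2))./2) (absz (k%:Z + s.2))]
  else [::].

(** The last bound says that the remaining width is at least the remaining height. *)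
Lemma mem_first_steps n k s : (s \in first_steps n k) <->
  [/\ S s, k%:Z = 0 -> ~ horizontal s, 0 <= k%:Z + s.2 & s.1 + s.2 <= n.*2%:Z].
Proof.
rewrite !mem_cat; split=> [/or3P[]|].
- case/mapP=> r; rewrite mem_filter mem_iota => /and3P[ur r1 rn] -> /=.
  split; [exists r; [lia|by left; split=> //; left] | | lia | lia].
  by move=> _ [q q0 []]; lia.
- case/mapP=> r; rewrite mem_filter mem_iota => /and3P[ur r1 rn] -> /=.
  split; [exists r; [lia|by left; split=> //; right] | | lia | lia].
  by move=> _ [q q0 []]; lia.
- case: ifP => // k0.
  case/mapP=> r; rewrite mem_filter mem_iota => /and3P[ur r1 rn] -> /=.
  by split; [exists r; [lia|by right] | lia | lia | lia].
case=> -[r r0 [[ur [|]]|[hr]]] -> nh /= ks sn; apply/or3P.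
- by apply: Or31; apply: map_f; rewrite mem_filter mem_iota ur; lia.
- apply: Or32; apply/mapP; exists r => //.
  by rewrite mem_filter mem_iota ur; lia.
- have k0 : (0 < k)%N.
    rewrite lt0n; apply/eqP => k0; apply: nh; first by rewrite k0.
    by exists r.
  apply: Or33; rewrite k0; apply/mapP; exists r => //.
  by rewrite mem_filter mem_iota hr; lia.
Qed.

(** The sign of the vertical component separates the three families. *)
Lemma first_steps_uniq n k : uniq (first_steps n k).
Proof.
have uniq_map (f : nat -> step) (a : pred nat) m : injective f ->
    uniq [seq f r | r <- iota 1 m & a r].
  by move=> /map_inj_uniq ->; rewrite filter_uniq ?iota_uniq.
rewrite !cat_uniq !uniq_map /=; try by move=> r q []; lia.
apply/and3P; split.
- apply/hasPn => s; rewrite mem_cat => /orP[|].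
    case/mapP=> r; rewrite mem_filter mem_iota => /and3P[_ r1 _] ->.
    by apply/negP => /mapP[q _ []]; lia.
  case: ifP => // _ /mapP[r]; rewrite mem_filter mem_iota => /and3P[_ r1 _] ->.
  by apply/negP => /mapP[q _ []]; lia.
- apply/hasPn => s; case: ifP => // _ /mapP[r].
  rewrite mem_filter mem_iota => /and3P[_ r1 _] ->.
  by apply/negP => /mapP[q _ []]; lia.
- by case: ifP => // _; apply: uniq_map => r q []; lia.
Qed.

Lemma paths_uniq fuel n k : uniq (paths fuel n k).
Proof.
elim: fuel n k => [|m IH] n k /=; first by case: ifP.
have uniq_cons : uniq [seq s :: p | s <- first_steps n k,
    p <- paths m (n - (absz (s.1 + s.2))./2) (absz (k%:Z + s.2))].
  apply: allpairs_uniq_dep => [|s _|]; rewrite ?first_steps_uniq //.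
  by case=> s p [t q] _ _ /= [-> ->].
case: ifP => _ //=; rewrite uniq_cons andbT.
by apply/negP => /allpairsPdep[s [p []]].
Qed.

(** Fuel bounding the width suffices, because every step has positive width. *)
Lemma mem_paths fuel n k p : (n.*2 + k <= fuel)%N ->
  (p \in paths fuel n k) <-> path_from S k%:Z (n.*2%:Z + k%:Z, - k%:Z) p.
Proof.
elim: fuel n k p => [|m IH] n k p le_fuel.
  have [-> ->] : n = 0%N /\ k = 0%N by lia.
  case: p => [|s p] /=.
    by rewrite inE eqxx path_from_nil; split.
  rewrite inE; split=> // /path_from_cons[/step_set_short[s1 s2] _ _].
  by move=> /(path_from_short step_set_short) /=; lia.
rewrite /= mem_cat; case: p => [|s p].
  rewrite path_from_nil; split=> [/orP[]|[[n0 k0] _]].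
  - by case: ifP => // /andP[/eqP-> /eqP->].
  - by case/allpairsPdep=> s [p []].
  - by have [-> ->] : n = 0%N /\ k = 0%N by lia.
rewrite path_from_cons [_ \in if _ then _ else _](_ : _ = false); last first.
  by case: ifP.
have nextP : S s -> 0 <= k%:Z + s.2 -> s.1 + s.2 <= n.*2%:Z ->
    p \in paths m (n - (absz (s.1 + s.2))./2) (absz (k%:Z + s.2)) <->
    path_from S (k%:Z + s.2) ((n.*2%:Z + k%:Z, - k%:Z) - s) p.
  move=> Ss ks sn; rewrite IH; last first.
    by case: Ss ks sn => r r0 [[_ [|]]|[_]] -> /=; lia.
  rewrite gez0_abs //.
  suff -> : ((n - (absz (s.1 + s.2))./2).*2%:Z + (k%:Z + s.2),
    - (k%:Z + s.2)) = (n.*2%:Z + k%:Z, - k%:Z) - s by [].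
  rewrite [RHS]surjective_pairing; congr pair => /=.
    by case: Ss ks sn => r r0 [[_ [|]]|[_]] -> /=; lia.
  by lia.
split=> [/allpairsPdep[t [q [+ + [? ?]]]]|[Ss _ nh sp]].
  subst t q => /mem_first_steps[Ss nh ks sn] qp.
  by split=> //; apply/nextP.
(* Shortness of the tail bounds its drop by its width, which is what [s] needs to be a listed first
   step. *)
have dle := path_from_short step_set_short sp.
have ks := path_from_ge0 sp.
have sn : s.1 + s.2 <= n.*2%:Z.
  have {}dle : `|- k%:Z - s.2| <= n.*2%:Z + k%:Z - s.1 := dle.
  by lia.
apply/allpairsPdep; exists s, p; split=> //.
  exact/mem_first_steps.
exact/nextP.
Qed.

Lemma fset_set_paths n :
  #|` fset_set (A S n)| = size (paths n.*2 n 0).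
Proof.
have A_paths p : A S n p <-> p \in paths n.*2 n 0.
  rewrite mem_paths ?addn0 // addr0 oppr0.
  split=> [] [pS pn ge0 nh]; split=> // i /[dup] lei.
  - by rewrite add0r => _; apply: ge0.
  - by rewrite add0r => _; apply: nh.
  - by move/ge0; rewrite add0r.
  - by move/nh; rewrite add0r.
rewrite -[RHS](congr1 size (undup_id (paths_uniq _ _ _))) -card_fseq.
congr #|` _ |; apply/fsetP => p.
rewrite in_fset_set; last exact/A_finite/step_set_short.
by rewrite inE; apply/idP/idP => [/set_mem/A_paths|/A_paths/mem_set].
Qed.

(** The recursion by first step refers only to smaller widths [2 n + k], so any solution [E] counts
    the paths. *)
Lemma size_paths (K : fieldType) (E : nat -> fps K) :
  (forall n k, coefs (E k) n = ((n == 0%N) && (k == 0%N))%:R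
     + \sum_(r <- iota 1 n | u r) coefs (E (k + r)%N) (n - r)
     + \sum_(r <- iota 1 k | u r) coefs (E (k - r)%N) n
     + (if (0 < k)%N then \sum_(r <- iota 1 n | h r) coefs (E k) (n - r)
        else 0)) ->
  forall fuel n k, (n.*2 + k <= fuel)%N ->
    (size (paths fuel n k))%:R = coefs (E k) n.
Proof.
move=> EE; elim=> [|m IH] n k le_fuel.
  have [-> ->] : n = 0%N /\ k = 0%N by lia.
  by rewrite EE /= !big_nil !addr0.
rewrite EE /= size_cat natrD -!addrA; congr (_ + _); first by case: ifP.
rewrite size_allpairs_dep sumnE !big_map natr_sum !big_cat /=.
rewrite !big_map /=; congr (_ + (_ + _)).
- rewrite -[RHS]big_filter; apply: eq_big_seq => r.
  rewrite mem_filter mem_iota => /and3P[_ r1 rn].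
  rewrite IH; last by lia.
  by congr (coefs (E _) _); lia.
- rewrite -[RHS]big_filter; apply: eq_big_seq => r.
  rewrite mem_filter mem_iota => /and3P[_ r1 rn].
  rewrite IH; last by lia.
  by congr (coefs (E _) _); lia.
case: ifP => k0; last by rewrite big_nil.
rewrite big_map -[RHS]big_filter; apply: eq_big_seq => r.
rewrite mem_filter mem_iota => /and3P[_ r1 rn].
rewrite [(_, _).1]/= [(_, _).2]/= IH; last by lia.
by congr (coefs (E _) _); lia.
Qed.

(** Reduces the computation of [Q] to exhibiting one solution; [V], [D] and [H] collect the up, down
    and horizontal first steps, the last absent at height 0. *)
Lemma Q_step_set (E V D : nat -> fps rat) (H : fps rat) :
  (forall k, E k = (k == 0%N)%:R + V k + D k
     + (if (0 < k)%N then H * E k else 0)) ->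
  (forall k n, coefs (V k) n =
     \sum_(r <- iota 1 n | u r) coefs (E (k + r)%N) (n - r)) ->
  (forall k n, coefs (D k) n =
     \sum_(r <- iota 1 k | u r) coefs (E (k - r)%N) n) ->
  (forall f n, coefs (H * f) n = \sum_(r <- iota 1 n | h r) coefs f (n - r)) ->
  Q S = E 0%N.
Proof.
move=> EE VE DE HE.
have Ecoef n k : coefs (E k) n = ((n == 0%N) && (k == 0%N))%:R
     + \sum_(r <- iota 1 n | u r) coefs (E (k + r)%N) (n - r)
     + \sum_(r <- iota 1 k | u r) coefs (E (k - r)%N) n
     + (if (0 < k)%N then \sum_(r <- iota 1 n | h r) coefs (E k) (n - r)
        else 0).
  rewrite {1}EE !coefsD VE DE -HE; congr (_ + _ + _ + _).
    by case: k => [|k]; rewrite ?andbT ?andbF ?coefs1 ?coefs0.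
  by case: ifP; rewrite ?coefs0.
have size0 := size_paths Ecoef (leqnn _).
apply: fps_ext => n; rewrite -size0 addn0.
(* The constant term 1 built into [Q] matches the empty path in [paths]. *)
case: n => [|n]; first by rewrite coefsD.
by rewrite coefsD coefs1 add0r /= fset_set_paths.
Qed.

End Counting.

(** * Quadratic equations for [Q] *)

Section Quadratics.
Local Notation x := (fpsX : fps rat).
Variables (h : pred nat) (H : fps rat).
Hypothesis HE : forall f n,
  coefs (x * H * f) n = \sum_(r <- iota 1 n | h r) coefs f (n - r).

(* With [w] the root of the kernel equation, [E_0 = q] and
   [E_(k+1) = q (w - 1) w^k]; [i] is [1 / (1 - x w)]. *)
Lemma Q_all_slopes : let q := Q (step_set xpredT h) in
  (1 - x * H) * (1 - x) * (q * (q - 1)) =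
  (q * (1 + x) - 1) * (q - 1) + x * q * (2 * q - 1).
Proof.
(* The coefficients come from the kernel equation, cleared of [i], expanded and solved for its term
   [w]. *)
have [w wE] := quadratic_fixpoint (2 - x * H) (x * H + H - 3) (2 - x * H).
have [i iE] := linear_fixpoint 1 w.
(* The equation at height 0, [E 0 = 1 + V 0]. *)
have [q qE] := linear_fixpoint 1 ((w - 1) * i).
have {}wE : (1 - x * H) * (1 - x * w) * (w - 1) =
    x * w * (w - 1) + (1 - x * w).
  by apply: (eq_of_subr wE); ring.
have iK : i * (1 - x * w) = 1 by apply: (eq_of_subr iE); ring.
have xw0 : 1 - x * w != 0.
  by apply: contra_eq_neq iK => ->; rewrite mulr0 eq_sym oner_neq0.
have kernel : (w - 1) * (1 - x * H - x * w * i) = 1.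
  apply: (mulIf xw0); rewrite mul1r.
  transitivity ((1 - x * H) * (1 - x * w) * (w - 1)
    - (w - 1) * x * w * (i * (1 - x * w))); first by ring.
  by rewrite wE iK; ring.
pose E k := if k is j.+1 then q * (w - 1) * w ^+ j else q.
(* [V k] is a geometric sum; [D k], the sum of [E] below [k], telescopes. *)
pose V k := q * (w - 1) * x * w ^+ k * i.
pose D k := if k is j.+1 then q * w ^+ j else 0.
have -> : Q (step_set xpredT h) = E 0%N.
  apply: (@Q_step_set _ _ E V D (x * H)) => // [[|k]|k n|k n].
  - by rewrite /V /= !addr0 {1}qE; ring.
  - apply: (eq_of_subr (congr1 ( *%R (q * w ^+ k)) kernel)).
    by rewrite /V /= !exprS; ring.
  - apply: diagonal_sumE => j.
    apply: (eq_of_subr (congr1 ( *%R (q * (w - 1) * x * w ^+ j)) iK)).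
    by rewrite /V /= exprS; ring.
  - apply: prefix_sumE => // -[|j] /=; first by rewrite addr0 mulr1.
    by rewrite exprS; ring.
rewrite [E 0%N]/= {E V D kernel} /=.
(* The height 0 equation is linear in [w], which allows its elimination. *)
have NE : q * (1 + x) - 1 = x * w * (2 * q - 1).
  have qxw : q * (1 - x * w) = 1 - x * w + x * (w - 1) * q.
    transitivity (1 - x * w + x * (w - 1) * q * (i * (1 - x * w))).
      by rewrite {1}qE; ring.
    by rewrite iK mulr1.
  by apply: (eq_of_subr qxw); ring.
have x1 : 1 - x != 0.
  by apply: coefs0_neq0; rewrite coefsD coefsN coefs1 subr0.
(* The kernel equation times [x * m ^+ 2], with [x * w * m] replaced by [n], has a common factor
   [1 - x]: [m - n = (1 - x) * q] and [n - x * m = (1 - x) * (q - 1)]. *)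
apply: (mulfI x1).
set n := q * (1 + x) - 1 in NE *; set m := 2 * q - 1 in NE *.
have kernel_n : (1 - x * H) * (m - n) * (n - x * m) =
    n * (n - x * m) + x * m * (m - n).
  by rewrite NE; apply: (eq_of_subr (congr1 ( *%R (x * m ^+ 2)) wE)); ring.
by apply: (eq_of_subr kernel_n); rewrite /n /m; ring.
Qed.

(* Here [E_k = q w^k] already for [k = 0]. *)
Lemma Q_unit_slopes : let q := Q (step_set (pred1 1%N) h) in
  (1 - x * H) * (q * (q - 1)) = (q - 1) ^+ 2 + x * q ^+ 2.
Proof.
(* [w] counts first descents by one level: a down step, or a horizontal step and a descent, or an up
   step and two descents. *)
have [w wE] := quadratic_fixpoint 1 H 1.
have [q qE] := linear_fixpoint 1 w.
pose E k := q * w ^+ k.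
pose V k := x * E k.+1.
pose D k := if k is j.+1 then E j else 0.
have -> : Q (step_set (pred1 1%N) h) = E 0%N.
  apply: (@Q_step_set _ _ E V D (x * H)) => // [[|k]|k n|k n].
  - by rewrite /V /E /= !addr0 expr0 expr1 {1}qE; ring.
  - apply: (eq_of_subr (congr1 ( *%R (q * w ^+ k)) wE)).
    by rewrite /V /= /E !exprS; ring.
  - by rewrite sum_pred1_iota coefsXM addn1; case: n => // n; rewrite subn1.
  - by rewrite sum_pred1_iota; case: k => [|k]; rewrite ?coefs0 // subn1.
rewrite /E expr0 mulr1 /=.
have q1 : q - 1 = x * w * q by apply: (eq_of_subr qE); ring.
rewrite q1; apply: (eq_of_subr (congr1 ( *%R (x * q ^+ 2)) wE)); ring.
Qed.

End Quadratics.

(** * The three step sets and their closed forms *)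

Lemma geometric_sumE (f : fps rat) n :
  coefs (fpsX * Fps (fun=> 1) * f) n =
  \sum_(r <- iota 1 n | xpredT r) coefs f (n - r).
Proof.
pose g : fps rat := Fps (fun=> 1).
have gE : g = 1 + fpsX * g.
  apply: fps_ext => -[|j].
    by rewrite coefsD coefsXM coefs1 addr0.
  by rewrite coefsD coefsXM coefs1 add0r.
(* As [g] is [1 / (1 - x)], the constant sequence [f] solves the unrolled recursion. *)
apply: (@diagonal_sumE _ (fun=> f) (fun=> fpsX * g * f) 0) => _.
by rewrite {1}gE; ring.
Qed.

Lemma S4E : S4 = step_set xpredT xpredT.
Proof.
apply/seteqP; split=> s [r r0].
  by case=> ->; exists (absz r); rewrite ?gtz0_abs //; try lia;
    [left; split; [|left] | left; split; [|right] | right].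
by case=> -[_]; [case|] => ->; exists r%:Z => //;
  [constructor 1 | constructor 2 | constructor 3].
Qed.

Lemma S5E : S5 = step_set (pred1 1%N) xpredT.
Proof.
apply/seteqP; split=> s [r r0].
  case=> ->; [exists 1%N | exists 1%N | exists (absz r)] => //.
  - by left; split=> //; left.
  - by left; split=> //; right.
  - by lia.
  - by right; rewrite gtz0_abs.
case=> -[]; last by exists r%:Z; [lia | constructor 3].
by move/eqP=> -> [] ->; exists 1 => //; [constructor 1 | constructor 2].
Qed.

Lemma S6E : S6 = step_set xpredT (pred1 1%N).
Proof.
apply/seteqP; split=> s [r r0].
  case=> ->; [exists (absz r) | exists (absz r) | exists 1%N] => //; try lia.
  - by left; rewrite gtz0_abs //; split=> //; left.
  - by left; rewrite gtz0_abs //; split=> //; right.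
  - by right.
case=> -[]; last by move/eqP=> -> ->; exists 1 => //; constructor 3.
move=> _ [] ->; exists r%:Z; try lia; by [constructor 1 | constructor 2].
Qed.

(* The quotients are taken in the fraction field of Q[[x]]. *)
Theorem corollary3p3 :
  let x : fps rat := fpsX in
  [/\ (Q S4)%:F =
        (1 + 4 * x - fps_sqrt (1 - 12 * x + 16 * x ^+ 2))%:F / (10 * x)%:F,
      (Q S5)%:F =
        (- 1 + fps_sqrt (1 - 8 * x + 12 * x ^+ 2 - 4 * x ^+ 3))%:F
          / (2 * x * (x - 2))%:F
    & (Q S6)%:F =
        (- 1 - 4 * x + x ^+ 2
           + fps_sqrt ((1 - x) * (1 - 11 * x + 7 * x ^+ 2 - x ^+ 3)))%:F
          / (2 * x * (x - 5))%:F].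
Proof.
move=> x.
have x0 : coefs x 0 = 0 by [].
have simp0 := (mulr0, mul0r, subr0, addr0).
have geom : x * Fps (fun=> 1) * (1 - x) = x.
  apply: fps_ext => n; rewrite -mulrA mulrBr mulr1 !coefsXM; case: n => // n.
  rewrite coefsD coefsN [_ * x]mulrC coefsXM.
  by case: n => [|n] /=; rewrite ?subr0 ?subrr.
have x1 : 1 - x != 0.
  by apply: coefs0_neq0; rewrite coefsD coefsN coefs1 subr0.
have nat_neq0 n : (n.+1%:R : fps rat) != 0.
  by apply: coefs0_neq0; rewrite coefs0_nat pnatr_eq0.
have xB_neq0 n : x - n.+1%:R != 0.
  apply: coefs0_neq0; rewrite coefsD coefsN coefs0_nat sub0r oppr_eq0.
  by rewrite pnatr_eq0.
have pred1_sumE (f : fps rat) n : coefs (x * 1 * f) n =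
    \sum_(r <- iota 1 n | pred1 1%N r) coefs f (n - r).
  by rewrite mulr1 sum_pred1_iota coefsXM; case: n => // n; rewrite subn1.
split.
- apply: tofrac_div; first by rewrite mulf_neq0 ?nat_neq0 ?fpsX_neq0.
  have := Q_all_slopes geometric_sumE; rewrite -S4E -/x /=.
  move: (Q S4) => q qE.
  have {}qE : 5 * x * q ^+ 2 - (1 + 4 * x) * q + 1 = 0.
    (* With [H = 1 / (1 - x)], the product [(1 - x * H) * (1 - x)] is [1 - x - x]. *)
    rewrite [X in X * _](_ : _ = 1 - 2 * x) in qE.
      by apply/esym/(eq_of_subr qE); ring.
    by apply: (eq_of_subr (esym geom)); ring.
  (* Completing the square: up to sign this is the derivative of the quadratic at [q], so its square
     is the discriminant; constant term 1 fixes the sign. *)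
  rewrite (@fps_sqrt_unique _ _ (1 + 4 * x - 10 * x * q)).
  + by ring.
  + by apply: (eq_of_subr (congr1 ( *%R (20 * x)) qE)); ring.
  + by rewrite !(coefsD, coefsN, coefs0M, coefs1) x0 !simp0.
- apply: tofrac_div.
    by rewrite mulf_neq0 ?xB_neq0 // mulf_neq0 ?nat_neq0 ?fpsX_neq0.
  have := Q_unit_slopes geometric_sumE; rewrite -S5E -/x /=.
  move: (Q S5) => q qE.
  have {}qE : x * (2 - x) * q ^+ 2 - q + 1 - x = 0.
    (* Multiplying by [1 - x] clears the denominator of [H]. *)
    move/(congr1 ( *%R (1 - x))): qE; rewrite mulrA.
    rewrite [X in X * _](_ : _ = 1 - 2 * x) => [qE|].
      by apply/esym/(eq_of_subr qE); ring.
    by apply: (eq_of_subr (esym geom)); ring.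
  rewrite (@fps_sqrt_unique _ _ (1 - 2 * x * (2 - x) * q)).
  + by ring.
  + by apply: (eq_of_subr (congr1 ( *%R (4 * x * (2 - x))) qE)); ring.
  + by rewrite !(coefsD, coefsN, coefs0M, coefs1) x0 !simp0.
apply: tofrac_div.
  by rewrite mulf_neq0 ?xB_neq0 // mulf_neq0 ?nat_neq0 ?fpsX_neq0.
have := Q_all_slopes pred1_sumE; rewrite -S6E -/x /=.
move: (Q S6) => q qE.
have {}qE : x * (5 - x) * q ^+ 2 - (1 + 4 * x - x ^+ 2) * q + 1 = 0.
  by apply/esym/(eq_of_subr qE); ring.
rewrite (@fps_sqrt_unique _ _ (1 + 4 * x - x ^+ 2 - 2 * x * (5 - x) * q)).
+ by ring.
+ by apply: (eq_of_subr (congr1 ( *%R (4 * x * (5 - x))) qE)); ring.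
+ by rewrite !(coefsD, coefsN, expr2, coefs0M, coefs1) x0 !simp0.
Qed.
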